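(* The Cliffordian Koebe function $f_K(x)=(1-x)^{-2}x$ is slice-regular on $\mathcal{Q}_{\mathbb{R}_3}\setminus\{1\}\supset\mathbb{B}$ and has the following properties. For every $x\in\mathbb{B}$, $$(f_K)'_s(x)=\mathcal{P}(x,1)=\frac{1-|x|^2}{|x-1|^4}.$$ For every $a\in\partial\mathbb{B}$ and $x\in\mathbb{B}$, $$(f_K)'_s(xa^c)=\mathcal{P}(x,a)=\frac{1-|x|^2}{|x-a|^4}.$$
   Context: $\mathbb{R}_3$ is the real Clifford algebra generated by $e_1,e_2,e_3$ with $e_ie_j+e_je_i=-2\delta_{ij}$; $x\mapsto x^c$ (Clifford conjugation) is the unique linear antiinvolution with $e_i^c=-e_i$. The paravector space $\{x_0+x_1e_1+x_2e_2+x_3e_3\}$ is identified with $\mathbb{R}^4$, and $\mathbb{B}$ is the open unit ball in $\mathbb{R}^4$. Let $\mathbb{S}_{\mathbb{R}_3}=\{J\in\mathbb{R}_3: J+J^c=0,\ JJ^c=1\}$ and let $\mathcal{Q}_{\mathbb{R}_3}=\bigcup_{J\in\mathbb{S}_{\mathbb{R}_3}}\langle1,J\rangle$ be the quadratic cone, equal to $\{x\in\mathbb{R}_3: x+x^c\in\mathbb{R},\ xx^c\in\mathbb{R}\}$; it contains $\mathbb{R}^4$ and all products $xa^c$ with $x,a\in\mathbb{R}^4$. For $x\in\mathcal{Q}_{\mathbb{R}_3}$, $\operatorname{Im}(x)=\frac{x-x^c}{2}$. For $D\subseteq\mathbb{C}$ conjugation-invariant, $\Omega_D=\{\alpha+J\beta:\alpha+i\beta\in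 D,\ J\in\mathbb{S}_{\mathbb{R}_3}\}$. A stem function on $D$ is a map $F=F_1+\imath F_2:D\to\mathbb{R}_3\otimes_{\mathbb{R}}\mathbb{C}$ ($F_1,F_2$ being $\mathbb{R}_3$-valued, $\imath^2=-1$) with $F(\overline z)=\overline{F(z)}$, where $\overline{a+\imath b}=a-\imath b$. It induces the (left) slice function $f=\mathcal{I}(F):\Omega_D\to\mathbb{R}_3$, $f(\alpha+J\beta)=F_1(\alpha+i\beta)+JF_2(\alpha+i\beta)$; $f$ is slice-regular if $F$ is holomorphic (with respect to the complex structure given by $\imath$). The function $f_K$ is the slice function induced by the classical Koebe function $F_K(z)=(1-z)^{-2}z$ on $\mathbb{C}\setminus\{1\}$. The spherical derivative of $f$ is $f'_s(x)=\frac12\operatorname{Im}(x)^{-1}(f(x)-f(x^c))$ for $x\notin\mathbb{R}$; for $f$ slice-regular it extends continuously to real points. $\mathcal{P}(x,a)=\frac{1-|x|^2}{|x-a|^4}$ ($x\in\mathbb{B}$, $a\in\partial\mathbb{B}$) is the Poisson kernel of $\mathbb{B}$. *)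

(* Defs.v *)
From HB Require Import structures.
From mathcomp Require Import all_boot all_order all_algebra all_field.
From mathcomp Require Import complex.
From mathcomp Require Import all_classical all_reals all_analysis.
From mathcomp Require Import ring.

Set Implicit Arguments.
Unset Strict Implicit.
Unset Printing Implicit Defensive.

Import Order.TTheory GRing.Theory Num.Theory.
Import numFieldNormedType.Exports.
Local Open Scope classical_set_scope.
Local Open Scope ring_scope.
Local Open Scope complex_scope.

(* The number i < 8 encodes the blade e_A, where A is the set of the p such    *)
(* that bit p of i is set (bit p standing for the generator e_(p+1)).          *)
(* e_A * e_B = +/- e_(A xor B), with one sign change for each pair (p, q) in   *)
(* A x B such that p > q (from e_p e_q = - e_q e_p) or p = q (from e_p^2 = -1). *)
Definition blade_sign (i j : nat) : bool :=
  odd (count (fun pq => Nat.testbit i pq.1 && Nat.testbit j pq.2)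
         [seq (p, q) | p <- iota 0 3, q <- iota 0 p.+1]).

Definition blade_grade (i : nat) : nat := count (Nat.testbit i) (iota 0 3).

Definition clifford3 (K : Type) : Type := 'rV[K]_8.

HB.instance Definition _ (K : nzRingType) := GRing.Lmodule.on (clifford3 K).
HB.instance Definition _ (K : nzRingType) := Vector.on (clifford3 K).
HB.instance Definition _ (K : numFieldType) :=
  NormedModule.copy (clifford3 K) 'rV[K]_8.

Definition coef (K : Type) (x : clifford3 K) (i : 'I_8) : K :=
  (x : 'rV[K]_8) ord0 i.

Definition blade (K : nzRingType) (i : nat) : clifford3 K :=
  delta_mx ord0 (inord i : 'I_8).

Definition clmul (K : nzRingType) (x y : clifford3 K) : clifford3 K :=
  \sum_(i < 8) \sum_(j < 8)
    ((-1) ^+ blade_sign i j * (coef x i * coef y j)) *: blade K (Nat.lxor i j).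

Lemma all_ltn8 (P : pred nat) : all P (iota 0 8) -> forall i : 'I_8, P i.
Proof. by move=> /allP h i; apply: h; rewrite mem_iota ltn_ord. Qed.

Lemma lxor_lt8 (i j : 'I_8) : (Nat.lxor i j < 8)%N.
Proof.
have := @all_ltn8 (fun i => all (fun j => Nat.lxor i j < 8)%N (iota 0 8)) isT i.
by move=> /(@all_ltn8 _)/(_ j).
Qed.

Lemma blade_cocycle (i j l : 'I_8) :
  (Nat.lxor (Nat.lxor i j) l == Nat.lxor i (Nat.lxor j l)) &&
  (blade_sign i j (+) blade_sign (Nat.lxor i j) l ==
   blade_sign j l (+) blade_sign i (Nat.lxor j l)).
Proof.
have := @all_ltn8 (fun i => all (fun j => all (fun l =>
  (Nat.lxor (Nat.lxor i j) l == Nat.lxor i (Nat.lxor j l)) &&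
  (blade_sign i j (+) blade_sign (Nat.lxor i j) l ==
   blade_sign j l (+) blade_sign i (Nat.lxor j l))) (iota 0 8)) (iota 0 8))
  isT i.
by move=> /(@all_ltn8 _)/(_ j)/(@all_ltn8 _)/(_ l).
Qed.

Section CliffordRing.
Context {K : comNzRingType}.
Implicit Types x y z : clifford3 K.

Lemma cliffordP x y : coef x =1 coef y -> x = y.
Proof. by move=> h; apply/rowP => i; exact: h. Qed.

Lemma coef_is_additive (i : 'I_8) (a : K) x y :
  coef (a *: x + y) i = a * coef x i + coef y i.
Proof. by rewrite /coef !mxE. Qed.

Lemma coef_blade (i : nat) (k : 'I_8) : (i < 8)%N ->
  coef (blade K i) k = (i == k)%:R.
Proof.
move=> i8; rewrite /coef mxE eqxx /=; congr (_%:R); congr nat_of_bool.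
by rewrite -val_eqE /= inordK // eq_sym.
Qed.

Fact clmul_linearl z : linear (@clmul K ^~ z).
Proof.
move=> a x y; rewrite /clmul scaler_sumr -big_split; apply: eq_bigr => i _ /=.
rewrite scaler_sumr -big_split; apply: eq_bigr => j _ /=.
rewrite scalerA -scalerDl coef_is_additive; congr (_ *: _); ring.
Qed.

Fact clmul_linearr z : linear (@clmul K z).
Proof.
move=> a x y; rewrite /clmul scaler_sumr -big_split; apply: eq_bigr => i _ /=.
rewrite scaler_sumr -big_split; apply: eq_bigr => j _ /=.
rewrite scalerA -scalerDl coef_is_additive; congr (_ *: _); ring.
Qed.

Let clmulr z x := clmul x z.
HB.instance Definition _ z :=
  GRing.isLinear.Build K (clifford3 K) (clifford3 K) *:%R (clmulr z)
    (clmul_linearl z).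
HB.instance Definition _ z :=
  GRing.isLinear.Build K (clifford3 K) (clifford3 K) *:%R (@clmul K z)
    (clmul_linearr z).

Lemma clmul_suml I (r : seq I) (P : pred I) (F : I -> clifford3 K) z :
  clmul (\sum_(i <- r | P i) F i) z = \sum_(i <- r | P i) clmul (F i) z.
Proof. exact: (linear_sum (clmulr z)). Qed.

Lemma clmul_sumr I (r : seq I) (P : pred I) (F : I -> clifford3 K) z :
  clmul z (\sum_(i <- r | P i) F i) = \sum_(i <- r | P i) clmul z (F i).
Proof. exact: (linear_sum (@clmul K z)). Qed.

Lemma clmulZl (a : K) x z : clmul (a *: x) z = a *: clmul x z.
Proof. exact: (linearZZ (clmulr z)). Qed.

Lemma clmulZr (a : K) x z : clmul z (a *: x) = a *: clmul z x.
Proof. exact: (linearZZ (@clmul K z)). Qed.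

Lemma clmul_bladel (a : nat) z : (a < 8)%N -> clmul (blade K a) z =
  \sum_(j < 8) ((-1) ^+ blade_sign a j * coef z j) *: blade K (Nat.lxor a j).
Proof.
move=> a8; rewrite /clmul (bigD1 (Ordinal a8)) //= [X in _ + X]big1 ?addr0; last first.
  move=> i ia; apply: big1 => j _.
  by rewrite coef_blade // eq_sym -[a]/(val (Ordinal a8)) val_eqE (negbTE ia)
    mul0r mulr0 scale0r.
by apply: eq_bigr => j _; rewrite coef_blade //= eqxx mul1r.
Qed.

Lemma clmul_blader (a : nat) z : (a < 8)%N -> clmul z (blade K a) =
  \sum_(i < 8) ((-1) ^+ blade_sign i a * coef z i) *: blade K (Nat.lxor i a).
Proof.
move=> a8; rewrite /clmul; apply: eq_bigr => i _.
rewrite (bigD1 (Ordinal a8)) //= [X in _ + X]big1 ?addr0; last first.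
  move=> j ja; rewrite coef_blade // eq_sym -[a]/(val (Ordinal a8)) val_eqE.
  by rewrite (negbTE ja) !mulr0 scale0r.
by rewrite coef_blade //= eqxx mulr1.
Qed.

Lemma clifford_sum_blade x : x = \sum_i coef x i *: blade K i.
Proof.
rewrite {1}[x](row_sum_delta x); apply: eq_bigr => i _.
by rewrite /blade inord_val.
Qed.

Fact clmulA : associative (@clmul K).
Proof.
move=> x y z; rewrite [clmul y z]/clmul [clmul x y]/clmul clmul_suml clmul_sumr.
transitivity (\sum_(i < 8) \sum_(j < 8) \sum_(l < 8)
   (((-1) ^+ (blade_sign i j (+) blade_sign (Nat.lxor i j) l)) *
   (coef x i * coef y j * coef z l)) *: blade K (Nat.lxor (Nat.lxor i j) l)).
  under eq_bigr do rewrite clmul_sumr.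
  under eq_bigr do under eq_bigr do rewrite clmulZr clmul_blader ?lxor_lt8 //
    scaler_sumr.
  under eq_bigr do rewrite exchange_big /=.
  rewrite exchange_big /=; apply: eq_bigr => i _; apply: eq_bigr => j _.
  apply: eq_bigr => l _; have /andP[/eqP -> /eqP ->] := blade_cocycle i j l.
  rewrite scalerA signr_addb; congr (_ *: _); ring.
apply: eq_bigr => i _; rewrite clmul_suml; apply: eq_bigr => j _.
rewrite clmulZl clmul_bladel ?lxor_lt8 // scaler_sumr; apply: eq_bigr => l _.
rewrite scalerA signr_addb; congr (_ *: _); ring.
Qed.

Fact clmul1 : left_id (blade K 0) (@clmul K).
Proof.
move=> x; rewrite clmul_bladel // [RHS]clifford_sum_blade.
apply: eq_bigr => i _.
have := @all_ltn8 (fun i => ~~ blade_sign 0 i && (Nat.lxor 0 i == i)) isT i.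
by move=> /andP[/negbTE -> /eqP ->]; rewrite mul1r.
Qed.

Fact cl1mul : right_id (blade K 0) (@clmul K).
Proof.
move=> x; rewrite clmul_blader // [RHS]clifford_sum_blade.
apply: eq_bigr => i _.
have := @all_ltn8 (fun i => ~~ blade_sign i 0 && (Nat.lxor i 0 == i)) isT i.
by move=> /andP[/negbTE -> /eqP ->]; rewrite mul1r.
Qed.

Fact clmulDl : left_distributive (@clmul K) +%R.
Proof. by move=> x y z; exact: (linearD (clmulr z)). Qed.

Fact clmulDr : right_distributive (@clmul K) +%R.
Proof. by move=> z x y; exact: (linearD (@clmul K z)). Qed.

Fact cl1_neq0 : blade K 0 != 0.
Proof.
apply/eqP => /(congr1 (fun x : clifford3 K => coef x ord0)).
by rewrite coef_blade // /coef mxE; exact/eqP/oner_neq0.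
Qed.

HB.instance Definition _ := GRing.Zmodule_isNzRing.Build (clifford3 K)
  clmulA clmul1 cl1mul clmulDl clmulDr cl1_neq0.

Fact clscaleAl (a : K) x y : a *: (x * y) = a *: x * y.
Proof. by rewrite [RHS]clmulZl. Qed.

HB.instance Definition _ :=
  GRing.Lmodule_isLalgebra.Build K (clifford3 K) clscaleAl.

Fact clscaleAr (a : K) x y : a *: (x * y) = x * (a *: y).
Proof. by rewrite [RHS]clmulZr. Qed.

HB.instance Definition _ :=
  GRing.Lalgebra_isAlgebra.Build K (clifford3 K) clscaleAr.

End CliffordRing.

(* A falgType is a unitRingType: x^-1 is the two-sided inverse of x when it    *)
(* exists, and x otherwise.                                                    *)
HB.instance Definition _ (K : fieldType) :=
  Algebra_isFalgebra.Build K (clifford3 K).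

Definition gen (K : nzRingType) (p : 'I_3) : clifford3 K := blade K (2 ^ p).

(* The linear antiinvolution with e_p |-> - e_p multiplies a blade of grade k  *)
(* by (-1)^k (-1)^(k(k-1)/2) = (-1)^(k(k+1)/2).                                *)
Definition clconj (K : nzRingType) (x : clifford3 K) : clifford3 K :=
  \row_i ((-1) ^+ 'C((blade_grade i).+1, 2) * coef x i).

Section CliffordFacts.
Context {K : comNzRingType}.
Implicit Types x y z : clifford3 K.

Lemma bladeM (i j : nat) : (i < 8)%N -> (j < 8)%N ->
  blade K i * blade K j = (-1) ^+ blade_sign i j *: blade K (Nat.lxor i j).
Proof.
move=> i8 j8; rewrite [LHS]clmul_bladel // (bigD1 (Ordinal j8)) //= [X in _ + X]big1 ?addr0.
  by rewrite coef_blade //= eqxx mulr1.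
move=> k kj; rewrite coef_blade // eq_sym -[j]/(val (Ordinal j8)) val_eqE.
by rewrite (negbTE kj) mulr0 scale0r.
Qed.

Lemma genM (p q : 'I_3) :
  gen K p * gen K q + gen K q * gen K p = (- 2 * (p == q)%:R)%:A.
Proof.
have one : 1 = blade K 0 by [].
rewrite one; case: p q => [[|[|[|//]]] hp] [[|[|[|//]]] hq].
all: rewrite /gen !bladeM //= -?scalerDl.
all: rewrite /= ?expr0 ?expr1 ?mulr0 ?scale0r ?subrr ?addNr ?scale0r //.
all: by congr (_ *: _); ring.
Qed.

(* The eight blades are the ordered products of distinct generators. *)
Lemma blade_gen (e := gen K) (e1 := e ord0) (e2 := e (inord 1)) (e3 := e ord_max) :
  [/\ blade K 0 = 1,
      [/\ blade K 1 = e1, blade K 2 = e2 & blade K 4 = e3],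
      [/\ blade K 3 = e1 * e2, blade K 5 = e1 * e3 & blade K 6 = e2 * e3] &
      blade K 7 = e1 * e2 * e3].
Proof.
rewrite /e1 /e2 /e3 /e /gen inordK //= !bladeM // !scale1r.
by rewrite bladeM // scale1r.
Qed.

Fact clconj_linear : linear (@clconj K).
Proof.
move=> a x y; apply/rowP => i; rewrite !mxE coef_is_additive; ring.
Qed.

HB.instance Definition _ := GRing.isLinear.Build K (clifford3 K) (clifford3 K)
  *:%R (@clconj K) clconj_linear.

Lemma clconj_blade (i : nat) : (i < 8)%N ->
  clconj (blade K i) = (-1) ^+ 'C((blade_grade i).+1, 2) *: blade K i.
Proof.
move=> i8; apply: cliffordP => k; rewrite -[RHS]/((_ *: _ : 'rV_8) ord0 k) mxE.
rewrite -[(blade K i : 'rV_8) _ _]/(coef _ k) /coef mxE -/(coef _ k) coef_blade //.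
by case: eqP => [->|]; rewrite ?mulr0.
Qed.

Lemma clconj_gen p : clconj (gen K p) = - gen K p.
Proof.
rewrite /gen clconj_blade; last by case: p => [[|[|[|]]]].
by case: p => [[|[|[|//]]] hp]; rewrite /= expr1 scaleN1r.
Qed.

Lemma clconjK : involutive (@clconj K).
Proof.
move=> x; apply/rowP => i; rewrite !mxE /coef mxE mulrA -expr2 sqrr_sign.
by rewrite mul1r.
Qed.

Lemma clconjM x y : clconj (x * y) = clconj y * clconj x.
Proof.
rewrite [x * y]/(clmul x y) [x in RHS]clifford_sum_blade.
rewrite [y in RHS]clifford_sum_blade !linear_sum /= mulr_sumr.
apply: eq_bigr => i _; rewrite mulr_suml linear_sum; apply: eq_bigr => j _ /=.
rewrite !linearZ /= !clconj_blade ?lxor_lt8 // -!scalerAl -!scalerAr bladeM //.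
rewrite !scalerA.
have := @all_ltn8 (fun i => all (fun j => (Nat.lxor i j == Nat.lxor j i) &&
  ((blade_sign i j (+) odd 'C((blade_grade (Nat.lxor i j)).+1, 2)) ==
   (odd 'C((blade_grade i).+1, 2) (+) odd 'C((blade_grade j).+1, 2) (+)
   blade_sign j i))) (iota 0 8)) isT i.
move=> /(@all_ltn8 _)/(_ j)/andP[/eqP <- /eqP /(congr1 (fun b : bool => (-1 : K) ^+ b))].
rewrite !signr_addb !signr_odd => h; congr (_ *: _).
rewrite mulrAC h; ring.
Qed.

End CliffordFacts.

Section SliceFunctions.
Context {R : realType}.
Local Notation R3 := (clifford3 R).

Definition imaginary_units : set R3 :=
  [set J | J + clconj J = 0 /\ J * clconj J = 1].

Definition quadratic_cone : set R3 :=
  \bigcup_(J in imaginary_units) [set x | exists a b : R, x = a%:A + b *: J].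

Definition clIm (x : R3) : R3 := 2^-1 *: (x - clconj x).

Definition paravector : set R3 :=
  [set x | exists (x0 : R) (v : 'I_3 -> R), x = x0%:A + \sum_p v p *: gen R p].

(* The norm `|x| of the library is the sup norm of the coefficients. *)
Definition enorm (x : R3) : R := Num.sqrt (\sum_i coef x i ^+ 2).

Definition unit_ball : set R3 := paravector `&` [set x | enorm x < 1].

Definition unit_sphere : set R3 := paravector `&` [set x | enorm x = 1].

Definition conj_invariant (D : set R[i]) := forall z, D z -> D z^*%C.

Definition circularization (D : set R[i]) : set R3 :=
  [set x | exists (a b : R) (J : R3),
     [/\ D (a +i* b), imaginary_units J & x = a%:A + b *: J]].

(* The complexification of R_3 is the complex algebra with the same blades:    *)
(* the element sum_A (a_A + i b_A) e_A is sum_A a_A e_A + i sum_A b_A e_A.     *)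
Local Notation R3C := (clifford3 R[i]).

Definition reC (w : R3C) : R3 := \row_k complex.Re (coef w k).
Definition imC (w : R3C) : R3 := \row_k complex.Im (coef w k).
Definition conjC (w : R3C) : R3C := \row_k (coef w k)^*%C.

Definition stem_function (D : set R[i]) (F : R[i] -> R3C) :=
  conj_invariant D /\ forall z, D z -> F z^*%C = conjC (F z).

Definition induced_by (D : set R[i]) (F : R[i] -> R3C) (f : R3 -> R3) :=
  forall (a b : R) (J : R3), D (a +i* b) -> imaginary_units J ->
    f (a%:A + b *: J) = reC (F (a +i* b)) + J * imC (F (a +i* b)).

Definition holomorphic (D : set R[i]) (F : R[i] -> R3C) :=
  open (D : set R[i]^o) /\
  forall z, D z -> derivable (F : R[i]^o -> R3C) z 1.

Definition slice_regular (Omega : set R3) (f : R3 -> R3) :=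
  exists (D : set R[i]) (F : R[i] -> R3C),
    [/\ Omega = circularization D, stem_function D F, holomorphic D F &
        induced_by D F f].

Definition real_points : set R3 := [set x | exists t : R, x = t%:A].

Definition spherical_quotient (f : R3 -> R3) (x : R3) : R3 :=
  2^-1 *: ((clIm x)^-1 * (f x - f (clconj x))).

(* d is the value at x of the spherical derivative of f : Omega -> R_3,        *)
(* extended by continuity to the real points of Omega.                         *)
Definition is_spherical_derivative (Omega : set R3) (f : R3 -> R3) (x d : R3) :=
  [/\ Omega x,
      (~ real_points x -> spherical_quotient f x = d) &
      (real_points x ->
       spherical_quotient f y @[y --> within (Omega `\` real_points) (nbhs x)]
         --> d)].

Definition poisson (x a : R3) : R := (1 - enorm x ^+ 2) / enorm (x - a) ^+ 4.

Definition koebeC (z : R[i]) : R3C := ((1 - z) ^- 2 * z)%:A.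

Definition koebe (x : R3) : R3 := (1 - x) ^- 2 * x.

End SliceFunctions.

(* Main.v *)
Require Import Defs.
From mathcomp Require Import all_boot all_order all_algebra.
From mathcomp Require Import complex.
From mathcomp Require Import all_classical all_reals all_analysis.
From mathcomp Require Import ring.
Import Order.TTheory GRing.Theory Num.Theory numFieldNormedType.Exports.
Local Open Scope classical_set_scope.
Local Open Scope ring_scope.

Set Implicit Arguments.
Unset Strict Implicit.
Unset Printing Implicit Defensive.

(** On each plane spanned by 1 and an imaginary unit J, the quadratic cone is a
    copy of the complex numbers: [slice_embed J] sends [a + i b] to [a + b J],
    is multiplicative because J squares to -1, and turns complex conjugation
    into Clifford conjugation and complex modulus into the Euclidean norm.
    Hence [koebe (slice_embed J z) = slice_embed J (F z)] for the classical
    Koebe function F, which is exactly the statement that F induces the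
    Cliffordian one; F is holomorphic off 1 and commutes with conjugation, so
    slice-regularity follows.

    The same identity shows that the spherical quotient at [slice_embed J z] is
    the real number [Im (F z) / Im z] (lemma [spherical_quotient_slice]).
    Multiplying numerator and denominator of F by the square of the conjugate
    of [1 - z] gives [F z = (z - 2 n + n conj(z)) / N ^ 2] with [n = |z|^2] and
    [N = |1 - z|^2], so this quotient is [(1 - n) / N ^ 2] (lemma [Im_koebe]),
    the Poisson kernel with pole 1.  It is continuous off 1, which settles the
    real points, and the formula holds on the whole of the cone minus 1
    (lemma [koebe_spherical_derivative]), not only on the ball.

    Thus the rotated statement needs only two facts about paravectors x and a
    with |a| = 1.  First, [x a^c] lies in the cone: its norm [x a^c a x^c] is
    |x|^2 and its trace is the polarization of the real quadratic form
    [x x^c]; real trace and real norm characterize the cone (lemma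
    [quadratic_cone_trace_norm]).  Second, right multiplication by [a^c]
    preserves the norm and [x a^c - 1 = (x - a) a^c], so the kernel with pole 1
    at [x a^c] is the kernel with pole a at x (lemma [poisson_mul_clconj]). *)

(** * The Clifford norm *)

Section Coefficients.
Context {K : comNzRingType}.
Implicit Types x y : clifford3 K.

Lemma coefZ (t : K) x i : coef (t *: x) i = t * coef x i.
Proof. by rewrite /coef mxE. Qed.

Lemma coef_alg (t : K) i : coef (t%:A : clifford3 K) i = t * (0%N == i)%:R.
Proof. by rewrite coefZ -[1]/(blade K 0) coef_blade. Qed.

End Coefficients.

Section Koebe.
Context {R : realType}.
Local Notation C := R[i]%C.
Local Notation R3 := (clifford3 R).
Implicit Types (x y a J : R3) (z w : C).

Lemma coef0A (t : R) : coef (t%:A : R3) 0 = t.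
Proof. by rewrite coef_alg mulr1. Qed.

Lemma clconj1 : clconj (1 : R3) = 1.
Proof. by rewrite -[1]/(blade R 0) clconj_blade //= scale1r. Qed.

Lemma clconjA (t : R) : clconj (t%:A : R3) = t%:A.
Proof. by rewrite linearZ /= clconj1. Qed.

(** Each blade satisfies [e_A e_A^c = 1], and products of distinct blades have no
    scalar part. *)
Lemma coef0_mul_clconj x : coef (x * clconj x) 0 = \sum_i coef x i ^+ 2.
Proof.
have coef_sum (F : 'I_8 -> R3) : coef (\sum_i F i) 0 = \sum_i coef (F i) 0.
  by rewrite /coef summxE.
rewrite [x * clconj x]/(clmul _ _) /clmul coef_sum; apply: eq_bigr => i _.
(* The sign with which e_i e_j^c contributes to the scalar part, settled by
   evaluation on all 64 pairs of blades. *)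
have sgn : forall j : 'I_8, (-1) ^+ blade_sign i j * (-1) ^+ 'C((blade_grade j).+1, 2)
    * (Nat.lxor i j == 0%N)%:R = (j == i)%:R :> R.
  move=> j; have := @all_ltn8 (fun i => all (fun j =>
    ((Nat.lxor i j == 0%N) == (j == i)) && ((j == i) ==> (blade_sign i j == odd 'C((blade_grade j).+1, 2)))) (iota 0 8)) isT i.
  move=> /(@all_ltn8 _)/(_ j)/andP[/eqP -> /implyP]; rewrite val_eqE.
  case: (j == i) => [/(_ isT)/eqP ->|_]; last by rewrite mulr0.
  by rewrite signr_odd -expr2 sqrr_sign mulr1.
rewrite coef_sum (bigD1 i) //= big1 ?addr0.
  rewrite coefZ coef_blade ?lxor_lt8 // [coef (clconj x) i]/coef mxE.
  have := sgn i; rewrite eqxx => h.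
  transitivity (((-1) ^+ blade_sign i i * (-1) ^+ 'C((blade_grade i).+1, 2)
    * (Nat.lxor i i == 0%N)%:R) * coef x i ^+ 2); last by rewrite h mul1r.
  by rewrite -/(coef x i); ring.
move=> j ji; rewrite coefZ coef_blade ?lxor_lt8 // [coef (clconj x) j]/coef mxE.
have := sgn j; rewrite (negbTE ji) => h.
transitivity (((-1) ^+ blade_sign i j * (-1) ^+ 'C((blade_grade j).+1, 2)
    * (Nat.lxor i j == 0%N)%:R) * (coef x i * coef x j)); last by rewrite h mul0r.
by rewrite -/(coef x j); ring.
Qed.

Lemma sqr_enorm x : enorm x ^+ 2 = coef (x * clconj x) 0.
Proof.
by rewrite coef0_mul_clconj /enorm sqr_sqrtr // sumr_ge0 // => i _; rewrite sqr_ge0.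
Qed.

Lemma enorm_ge0 x : 0 <= enorm x. Proof. exact: sqrtr_ge0. Qed.

Lemma enorm_eq0 x : enorm x = 0 -> x = 0.
Proof.
move=> /(congr1 (fun t => t ^+ 2)); rewrite sqr_enorm coef0_mul_clconj expr0n /=.
move=> /eqP; rewrite psumr_eq0 => [/allP h|i _]; last by rewrite sqr_ge0.
apply: cliffordP => i; have := h i (mem_index_enum _).
by rewrite sqrf_eq0 => /eqP ->; rewrite /coef mxE.
Qed.

(** Lets every Euclidean norm below be computed by Clifford algebra. *)
Lemma enorm_scalar_norm x (n : R) : x * clconj x = n%:A -> enorm x ^+ 2 = n.
Proof. by rewrite sqr_enorm => ->; rewrite coef0A. Qed.

Lemma enorm1 : enorm (1 : R3) = 1.
Proof.
have : enorm (1 : R3) ^+ 2 = 1 by apply: enorm_scalar_norm; rewrite clconj1 mulr1 scale1r.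
by move/eqP; rewrite sqrp_eq1 ?enorm_ge0 // => /eqP.
Qed.

Lemma enorm_mulr_unit y a : clconj a * a = 1 -> enorm (y * clconj a) = enorm y.
Proof.
move=> a1; apply/eqP; rewrite -(@eqrXn2 _ 2) ?enorm_ge0 // !sqr_enorm clconjM clconjK.
by rewrite -mulrA [clconj a * _]mulrA a1 mul1r.
Qed.

(** * Paravectors *)

Lemma paravectorD x y : paravector x -> paravector y -> paravector (x + y).
Proof.
move=> [x0 [v ->]] [y0 [w ->]]; exists (x0 + y0), (fun p => v p + w p).
rewrite scalerDl addrACA -big_split /=; congr (_ + _).
by apply: eq_bigr => p _; rewrite scalerDl.
Qed.

Lemma clconj_paravector (x0 : R) (v : 'I_3 -> R) :
  clconj (x0%:A + \sum_p v p *: gen R p) = x0%:A - \sum_p v p *: gen R p.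
Proof.
rewrite linearD /= clconjA -sumrN linear_sum /=; congr (_ + _).
by apply: eq_bigr => p _; rewrite linearZ /= clconj_gen scalerN.
Qed.

Lemma paravector_trace x : paravector x -> exists t : R, x + clconj x = t%:A.
Proof.
move=> [x0 [v ->]]; exists (x0 + x0).
by rewrite clconj_paravector addrACA subrr addr0 scalerDl.
Qed.

(** Averaging the double sum with its transpose leaves only anticommutators. *)
Lemma sqr_vector (v : 'I_3 -> R) :
  (\sum_p v p *: gen R p) ^+ 2 = (- \sum_p v p ^+ 2)%:A.
Proof.
have E : (\sum_p v p *: gen R p) ^+ 2 =
    \sum_p \sum_q (v p * v q) *: (gen R p * gen R q).
  rewrite expr2 mulr_suml; apply: eq_bigr => p _; rewrite mulr_sumr.
  by apply: eq_bigr => q _; rewrite -scalerAl -scalerAr scalerA.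
have E' : (\sum_p v p *: gen R p) ^+ 2 =
    \sum_p \sum_q (v p * v q) *: (gen R q * gen R p).
  rewrite E exchange_big /=; apply: eq_bigr => p _; apply: eq_bigr => q _.
  by rewrite mulrC.
apply: (@scalerI _ _ (2 : R)); first by rewrite pnatr_eq0.
rewrite scaler_nat mulr2n {1}E E' -big_split /= scalerA.
rewrite -sumrN mulr_sumr scaler_suml; apply: eq_bigr => p _.
rewrite -big_split /= (bigD1 p) //= big1 ?addr0 => [|q qp].
  by rewrite -scalerDr genM eqxx mulr1 scalerA; congr (_ *: _); ring.
by rewrite -scalerDr genM eq_sym (negbTE qp) mulr0 scale0r scaler0.
Qed.

Lemma paravector_norm x : paravector x -> x * clconj x = (enorm x ^+ 2)%:A.
Proof.
move=> px; suff [n xn] : exists n : R, x * clconj x = n%:A.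
  by rewrite (enorm_scalar_norm xn).
case: px => x0 [v ->]; rewrite clconj_paravector.
set V := \sum_p _; exists (x0 ^+ 2 + \sum_p v p ^+ 2).
rewrite mulrDl !mulrBr !mulr_algl mulr_algr -[V * V]expr2 sqr_vector.
by rewrite addrA subrK scaleNr opprK scalerA -expr2 scalerDl.
Qed.

(** The conjugate of a paravector is a real number minus the paravector, so the
    two commute. *)
Lemma paravector_normC x : paravector x -> clconj x * x = x * clconj x.
Proof.
move=> px; have [t xt] := paravector_trace px.
have -> : clconj x = t%:A - x by rewrite -xt addrC addKr.
by rewrite mulrBl mulrBr mulr_algl mulr_algr.
Qed.

(** The trace of [x a^c] is the polar form of the real quadratic form [x x^c]. *)
Lemma paravector_mul_trace x a : paravector x -> paravector a ->
  exists t : R, x * clconj a + clconj (x * clconj a) = t%:A.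
Proof.
move=> px pa; have pxa := paravectorD px pa.
exists (enorm (x + a) ^+ 2 - enorm x ^+ 2 - enorm a ^+ 2).
rewrite !scalerBl -!paravector_norm // linearD /= clconjM clconjK mulrDl !mulrDr.
set p := x * clconj x; set s := a * clconj a.
by rewrite -(addrA p) (addrC p) addrK addrA addrK.
Qed.

(** * The complex slices of the quadratic cone *)

Lemma imaginary_unitP J : imaginary_units J <-> clconj J = - J /\ J * J = -1.
Proof.
split=> [[JN JJ]|[JN JJ]].
  have E : clconj J = - J by apply/eqP; rewrite -addr_eq0 addrC JN.
  by split=> //; rewrite -JJ E mulrN opprK.
by split; rewrite JN ?subrr // mulrN JJ opprK.
Qed.

Definition slice_embed J z : R3 := (complex.Re z)%:A + complex.Im z *: J.

Lemma slice_embedB J z w : slice_embed J (z - w) = slice_embed J z - slice_embed J w.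
Proof.
by case: z w => [a b] [c d]; rewrite /slice_embed /= !scalerBl opprD addrACA.
Qed.

Lemma slice_embed1 J : slice_embed J 1 = 1.
Proof. by rewrite /slice_embed /= scale1r scale0r addr0. Qed.

Section Slice.
Variable J : R3.
Hypothesis HJ : imaginary_units J.

Lemma slice_embedM z w : slice_embed J (z * w) = slice_embed J z * slice_embed J w.
Proof.
have [_ JJ] := (imaginary_unitP J).1 HJ.
case: z w => [a b] [c d]; rewrite /slice_embed /= mulrDl !mulrDr.
rewrite !mulr_algl mulr_algr -scalerAl -scalerAr JJ !scalerA !scalerN scalerBl scalerDl.
by rewrite (mulrC c b) [_ + (b * c) *: J]addrC addrACA [in RHS]addrACA [- _ + _]addrC.
Qed.

Lemma slice_embedV z : z != 0 -> slice_embed J z^-1 = (slice_embed J z)^-1.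
Proof.
move=> z0; have zU : slice_embed J z \is a GRing.unit.
  apply/unitrP; exists (slice_embed J z^-1).
  by rewrite -!slice_embedM mulVf // mulfV // slice_embed1.
by apply: (mulrI zU); rewrite mulrV // -slice_embedM mulfV // slice_embed1.
Qed.

Lemma clconj_slice_embed z : clconj (slice_embed J z) = slice_embed J z^*%C.
Proof.
have [JN _] := (imaginary_unitP J).1 HJ.
by case: z => a b; rewrite /slice_embed /= linearD /= clconjA
  linearZ /= JN scaleNr scalerN.
Qed.

Lemma sqr_enorm_slice_embed z :
  enorm (slice_embed J z) ^+ 2 = complex.Re z ^+ 2 + complex.Im z ^+ 2.
Proof.
apply: enorm_scalar_norm; rewrite clconj_slice_embed -slice_embedM.
case: z => a b; rewrite /slice_embed /=.
have -> : a * - b + b * a = 0 by ring.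
by rewrite scale0r addr0; congr (_ *: _); ring.
Qed.

Lemma slice_embed_inj : injective (slice_embed J).
Proof.
move=> z w /eqP; rewrite -subr_eq0 -slice_embedB => /eqP e.
have := sqr_enorm_slice_embed (z - w).
rewrite e -(scale0r (1 : R3)) (@enorm_scalar_norm _ 0) ?scale0r ?mul0r //.
move/esym/eqP; rewrite paddr_eq0 ?sqr_ge0 // !sqrf_eq0 => /andP[/eqP r /eqP i].
by apply/eqP; rewrite -subr_eq0 eq_complex r i /= !eqxx.
Qed.

Lemma koebe_slice_embed z : z != 1 ->
  koebe (slice_embed J z) = slice_embed J ((1 - z) ^- 2 * z).
Proof.
move=> z1; have z1' : 1 - z != 0 by rewrite subr_eq0 eq_sym.
rewrite /koebe slice_embedM slice_embedV ?expf_neq0 //.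
by rewrite !expr2 slice_embedM slice_embedB slice_embed1.
Qed.

(** A function that acts on the slice as a complex function w of z, compatible
    with conjugation, has a real spherical quotient: in the difference of the
    two values the real parts cancel, leaving a real multiple of J, and J is
    cancelled by the inverse of the imaginary part. *)
Lemma spherical_quotient_slice f z w : complex.Im z != 0 ->
  f (slice_embed J z) = slice_embed J w ->
  f (slice_embed J z^*%C) = slice_embed J w^*%C ->
  spherical_quotient f (slice_embed J z) = (complex.Im w / complex.Im z)%:A.
Proof.
have [_ JJ] := (imaginary_unitP J).1 HJ.
move=> z0 fz fzc; rewrite /spherical_quotient /clIm clconj_slice_embed fz fzc.
have sub_conj u : slice_embed J u - slice_embed J u^*%C = (complex.Im u *+ 2) *: J.
  case: u => a b; rewrite /slice_embed /= opprD addrACA subrr add0r scaleNr opprK.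
  by rewrite -scalerDl mulr2n.
rewrite !sub_conj scalerA -[complex.Im z *+ 2]mulr_natl mulKf ?pnatr_eq0 //.
set X := complex.Im z *: J; have XU : X \is a GRing.unit.
  apply/unitrP; exists (- (complex.Im z)^-1 *: J).
  by rewrite /X -!scalerAl -!scalerAr JJ !scalerA mulNr mulrN mulVf //
    mulfV // scalerN scaleNr opprK scale1r.
have -> : (complex.Im w *+ 2) *: J = (2 * (complex.Im w / complex.Im z)) *: X.
  by rewrite scalerA -mulrA divfK // mulr_natl.
by rewrite -scalerAr mulVr // scalerA mulKf ?pnatr_eq0.
Qed.

End Slice.

(** * The Koebe function on a slice *)

Lemma koebe_conj z : (1 - z^*%C) ^- 2 * z^*%C = ((1 - z) ^- 2 * z)^*%C.
Proof. by rewrite rmorphM fmorphV rmorphXn rmorphB rmorph1. Qed.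

Lemma Im_koebe (a b : R) (z := (a +i* b)%C) : z != 1 ->
  complex.Im ((1 - z) ^- 2 * z) =
    b * ((1 - (a ^+ 2 + b ^+ 2)) / ((a - 1) ^+ 2 + b ^+ 2) ^+ 2).
Proof.
move=> z1; have z1' : 1 - z != 0 by rewrite subr_eq0 eq_sym.
set N := (a - 1) ^+ 2 + b ^+ 2.
have N0 : N != 0.
  rewrite /N paddr_eq0 ?sqr_ge0 // !sqrf_eq0 subr_eq0; apply: contraNN z1.
  by rewrite eq_complex.
pose n := a ^+ 2 + b ^+ 2.
(* With n = |z|^2 and N = |1 - z|^2, this is (z - 2 n + n conj(z)) / N^2. *)
suff -> : (1 - z) ^- 2 * z = ((a - 2 * n + n * a) / N ^+ 2 +i* (b * (1 - n) / N ^+ 2))%C.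
  by rewrite /= mulrA.
apply: (mulfI (expf_neq0 2 z1')); rewrite mulrA divff ?expf_neq0 // mul1r.
apply/eqP; rewrite eq_complex /= /n; apply/andP; split; apply/eqP.
  by rewrite /N; field.
by rewrite /N; field.
Qed.

(** * Characterization of the quadratic cone *)

Lemma quadratic_coneP x :
  quadratic_cone x <-> exists2 J, imaginary_units J & exists z, x = slice_embed J z.
Proof.
split=> [[J HJ [a [b ->]]]|[J HJ [z ->]]]; exists J => //; first by exists (a +i* b)%C.
by exists (complex.Re z), (complex.Im z).
Qed.

Lemma imaginary_units_gen : imaginary_units (gen R ord0).
Proof.
apply/imaginary_unitP; split; first exact: clconj_gen.
have := genM (K := R) ord0 ord0; rewrite eqxx mulr1 -mulr2n -scaler_nat => h.
apply: (@scalerI _ _ (2 : R)); first by rewrite pnatr_eq0.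
by rewrite h scaleNr scalerN.
Qed.

(** The trace-free part w of x has [w^c = - w] and real norm |w|^2, hence
    [w^2 = - |w|^2]: it is a multiple of the imaginary unit [w / |w|]. *)
Lemma quadratic_cone_trace_norm x (t n : R) :
  x + clconj x = t%:A -> x * clconj x = n%:A -> quadratic_cone x.
Proof.
move=> xt xn; apply/quadratic_coneP.
pose w := clIm x; have xE : x = (t / 2)%:A + w.
  rewrite /w /clIm mulrC -scalerA -xt -scalerDr addrACA subrr addr0.
  by rewrite -mulr2n -[x *+ 2]scaler_nat scalerA mulVf ?pnatr_eq0 // scale1r.
have wN : clconj w = - w.
  by rewrite /w /clIm linearZ /= linearB /= clconjK -scalerN opprB.
have ww : w * clconj w = (n - (t / 2) ^+ 2)%:A.
  have -> : w = x - (t / 2)%:A by rewrite {1}xE addrC addKr.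
  rewrite linearB /= clconjA mulrBr !mulrBl xn !mulr_algl mulr_algr.
  rewrite opprB addrA scalerA -addrA addrACA -opprD -scalerDr [clconj x + x]addrC.
  by rewrite xt scalerA -scaleNr -!scalerDl; congr (_ *: _); field.
have ww' : w * clconj w = (enorm w ^+ 2)%:A by rewrite (enorm_scalar_norm ww).
have [w0|w0] := eqVneq (enorm w) 0.
  (* x is real, and lies in every slice. *)
  exists (gen R ord0); first exact: imaginary_units_gen.
  exists (t / 2 +i* 0)%C; rewrite /slice_embed /= scale0r addr0.
  by rewrite {1}xE (enorm_eq0 w0) addr0.
exists ((enorm w)^-1 *: w); last first.
  by exists (t / 2 +i* enorm w)%C; rewrite /slice_embed /= scalerA mulfV // scale1r.
apply/imaginary_unitP; split; first by rewrite linearZ /= wN scalerN.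
rewrite -scalerAl -scalerAr; have -> : w * w = - (w * clconj w) by rewrite wN mulrN opprK.
rewrite ww' !scalerN !scalerA -[X in - (X *: _)](_ : 1 = _) ?scale1r //.
by field.
Qed.

Lemma paravector_quadratic_cone x : paravector x -> quadratic_cone x.
Proof.
move=> px; have [t xt] := paravector_trace px.
exact: quadratic_cone_trace_norm xt (paravector_norm px).
Qed.

Lemma clconj_mul_unit_sphere a : unit_sphere a -> clconj a * a = 1.
Proof.
by move=> [pa a1]; rewrite paravector_normC // paravector_norm // a1 expr1n scale1r.
Qed.

Lemma mul_clconj_quadratic_cone x a :
  paravector x -> unit_sphere a -> quadratic_cone (x * clconj a).
Proof.
move=> px Sa; have [t xat] := paravector_mul_trace px Sa.1.
apply: (quadratic_cone_trace_norm xat (n := enorm x ^+ 2)).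
by rewrite clconjM clconjK -mulrA [clconj a * _]mulrA clconj_mul_unit_sphere //
  mul1r paravector_norm.
Qed.

(** Because [a a^c = 1], the difference [x a^c - 1] factors as [(x - a) a^c]. *)
Lemma poisson_mul_clconj x a : unit_sphere a ->
  poisson (x * clconj a) 1 = poisson x a.
Proof.
move=> Sa; have aa := clconj_mul_unit_sphere Sa.
have aa' : a * clconj a = 1 by case: Sa => pa _; rewrite -paravector_normC.
by rewrite /poisson enorm_mulr_unit // -aa' -mulrBl enorm_mulr_unit.
Qed.

(** * Slice-regularity *)

Lemma quadratic_cone_circularization :
  quadratic_cone `\` [set 1] = circularization (~` [set 1 : C]).
Proof.
apply/seteqP; split=> [x [[J HJ [a [b xE]]] x1]|x [a [b [J [z1 HJ ->]]]]].
  exists a, b, J; split=> // -[a1 b0]; apply: x1.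
  by rewrite /= xE a1 b0 scale1r scale0r addr0.
split; first by exists J => //; exists a, b.
move=> /= e; apply: z1 => /=; apply: (slice_embed_inj HJ).
by rewrite slice_embed1.
Qed.

Lemma koebeC_stem : stem_function (~` [set 1]) (@koebeC R).
Proof.
split=> [z z1 /= zc|z _].
  by apply: z1; rewrite /= -[z]conjcK zc rmorph1.
rewrite /koebeC koebe_conj; apply: cliffordP => k; rewrite [RHS]/coef mxE !coef_alg.
by rewrite [RHS]rmorphM rmorph_nat.
Qed.

Lemma reC_alg z : reC (z%:A) = (complex.Re z)%:A :> R3.
Proof.
apply: cliffordP => k; rewrite [LHS]/coef mxE !coef_alg.
by case: z => a b; case: eqP => _; rewrite ?mulr1 ?mulr0.
Qed.

Lemma imC_alg z : imC (z%:A) = (complex.Im z)%:A :> R3.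
Proof.
apply: cliffordP => k; rewrite [LHS]/coef mxE !coef_alg.
by case: z => a b; case: eqP => _; rewrite ?mulr1 ?mulr0.
Qed.

Lemma koebe_induced : induced_by (~` [set 1]) koebeC (@koebe R).
Proof.
move=> a b J /eqP z1 HJ; rewrite -[_ + _]/(slice_embed J (a +i* b)%C).
by rewrite koebe_slice_embed // /koebeC reC_alg imC_alg mulr_algr.
Qed.

Lemma koebeC_holomorphic : holomorphic (~` [set 1]) (@koebeC R).
Proof.
split.
  apply: closed_openC; apply: accessible_closed_set1.
  exact/hausdorff_accessible/norm_hausdorff.
move=> z /eqP z1; rewrite /koebeC.
have z1' : 1 - z != 0 by rewrite subr_eq0 eq_sym.
have d1 : derivable (fun w : C^o => 1 - w : C^o) z 1.
  by apply: (@derivableB C C^o C^o (cst (1 : C^o)) id);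
    [exact: derivable_cst|exact: derivable_id].
have d2 : derivable (fun w : C^o => (1 - w) ^+ 2 : C^o) z 1.
  exact: (@derivableX _ _ (fun w : C^o => 1 - w : C^o) 2).
have d3 : derivable (fun w : C^o => (1 - w) ^- 2 * w : C^o) z 1.
  apply: (@derivableM _ _ (fun w : C^o => (1 - w) ^- 2 : C^o) id);
    last exact: derivable_id.
  by apply: (@derivableV _ _ (fun w : C^o => (1 - w) ^+ 2 : C^o)) => //; exact: expf_neq0.
move: d3; set g := (fun w : C^o => _ : C^o) => /cvg_ex[/= l gl].
apply/cvg_ex; exists (l *: (1 : clifford3 C)) => /=.
(* The increments of [u *: 1] are those of u, carried by the continuous map
   [k |-> k *: 1]. *)
have -> : (fun h : C => h^-1 *: (((1 - (h%:A + z)) ^- 2 * (h%:A + z))%:A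
    - ((1 - z) ^- 2 * z)%:A : clifford3 C)) =
    (fun k : C => k *: (1 : clifford3 C)) \o (fun h : C => h^-1 *: (g (h%:A + z) - g z)).
  by apply/funext => h /=; rewrite -scalerBl scalerA.
by apply: cvg_comp gl _; exact: scalel_continuous.
Qed.

(** * The spherical derivative *)

Lemma poisson_slice_embed J z : imaginary_units J ->
  poisson (slice_embed J z) 1 = (1 - (complex.Re z ^+ 2 + complex.Im z ^+ 2)) /
    ((complex.Re z - 1) ^+ 2 + complex.Im z ^+ 2) ^+ 2.
Proof.
move=> HJ; rewrite /poisson -(slice_embed1 J) -slice_embedB.
rewrite -[4%N]/(2 * 2)%N exprM !sqr_enorm_slice_embed //.
by case: z => a b /=; rewrite subr0.
Qed.

Lemma koebe_spherical_quotient x : (quadratic_cone `\` [set 1]) x -> ~ real_points x ->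
  spherical_quotient koebe x = (poisson x 1)%:A.
Proof.
move=> [/quadratic_coneP[J HJ [z ->]] x1] xr.
have z1 : z != 1 by apply/eqP => z1; apply: x1; rewrite /= z1 slice_embed1.
have z0 : complex.Im z != 0.
  apply/eqP => z0; apply: xr; exists (complex.Re z).
  by rewrite /slice_embed z0 scale0r addr0.
have zc1 : z^*%C != 1 by rewrite -(inj_eq (can_inj (@conjcK R))) conjcK rmorph1.
rewrite (@spherical_quotient_slice J HJ koebe z ((1 - z) ^- 2 * z)) //.
- rewrite poisson_slice_embed //; case: z z1 z0 {x1 xr zc1} => a b z1 z0.
  by rewrite Im_koebe //= mulrC mulKf.
- exact: koebe_slice_embed.
- by rewrite koebe_slice_embed // koebe_conj.
Qed.

Lemma coef_continuous i : continuous (fun x : R3 => coef x i).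
Proof. exact: (@coord_continuous R 1 8 ord0 i). Qed.

Lemma enorm_continuous : continuous (@enorm R).
Proof.
move=> x; apply: (@continuous_comp R3 R R _ Num.sqrt); last exact: sqrt_continuous.
apply: (@cvg_big _ _ _ _ _ add_continuous _ (nbhs x)) => i _.
apply: (@cvg_comp _ _ _ (fun y : R3 => coef y i) (fun t : R => t ^+ 2));
  [exact: coef_continuous|exact: exprn_continuous].
Qed.

Lemma poisson_continuous x : x != 1 -> {for x, continuous (fun y : R3 => poisson y 1)}.
Proof.
move=> x1; have x1' : enorm (x - 1) != 0.
  by apply: contraNN x1 => /eqP/enorm_eq0/eqP; rewrite subr_eq0.
have cX (n : nat) (g : R3 -> R) : {for x, continuous g} ->
    {for x, continuous (fun y => g y ^+ n)}.
  by move=> cg; exact: (@continuous_comp _ _ _ g (fun t => t ^+ n) x cg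
    (@exprn_continuous R n (g x))).
apply: continuousM.
  by apply: continuousB; [exact: cst_continuous|apply: cX; exact: enorm_continuous].
apply: continuousV; first exact: expf_neq0.
apply: cX; apply: (@continuous_comp _ _ _ (fun y : R3 => y - 1) (@enorm R)).
  by apply: continuousB; [exact: cvg_id|exact: cst_continuous].
exact: enorm_continuous.
Qed.

(** At a real point the value is forced by continuity: nearby nonreal points
    carry the Poisson kernel, which is continuous away from its pole. *)
Lemma koebe_spherical_derivative x : (quadratic_cone `\` [set 1]) x ->
  is_spherical_derivative (quadratic_cone `\` [set 1]) koebe x (poisson x 1)%:A.
Proof.
move=> Ox; split=> // [|_]; first exact: koebe_spherical_quotient.
have c : (fun y : R3 => (poisson y 1)%:A : R3) @ x --> ((poisson x 1)%:A : R3).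
  apply: (@cvg_comp _ _ _ (fun y : R3 => poisson y 1) (fun k : R => k *: (1 : R3))).
    by apply: poisson_continuous; apply/eqP; case: Ox.
  exact: scalel_continuous.
apply: cvg_trans (cvg_within_filter _ c); apply: near_eq_cvg.
rewrite near_withinE; apply: nearW => y [Oy yr].
by rewrite koebe_spherical_quotient.
Qed.

Lemma enorm_lt1_neq1 x : enorm x < 1 -> x <> 1.
Proof. by move=> h x1; move: h; rewrite x1 enorm1 ltxx. Qed.

End Koebe.

Theorem corollary5p3 (R : realType) :
  let Omega : set (clifford3 R) := quadratic_cone `\` [set 1] in
  let D : set R[i]%C := ~` [set 1] in
  [/\ (* f_K is the slice function induced by the classical Koebe function *)
      stem_function D koebeC /\ induced_by D koebeC (@koebe R),
      slice_regular Omega koebe,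
      unit_ball `<=` Omega,
      (forall x : clifford3 R, unit_ball x ->
         is_spherical_derivative Omega koebe x (poisson x 1)%:A) &
      (forall a x : clifford3 R, unit_sphere a -> unit_ball x ->
         is_spherical_derivative Omega koebe (x * clconj a) (poisson x a)%:A)].
Proof.
have ball_sub : @unit_ball R `<=` quadratic_cone `\` [set 1].
  by move=> x [px x1]; split; [exact: paravector_quadratic_cone|exact: enorm_lt1_neq1].
split.
- by split; [exact: koebeC_stem|exact: koebe_induced].
- exists (~` [set 1]), koebeC; split.
  + exact: quadratic_cone_circularization.
  + exact: koebeC_stem.
  + exact: koebeC_holomorphic.
  + exact: koebe_induced.
- exact: ball_sub.
- by move=> x /ball_sub; exact: koebe_spherical_derivative.
- move=> a x Sa [px x1]; rewrite -poisson_mul_clconj //.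
  apply: koebe_spherical_derivative; split; first exact: mul_clconj_quadratic_cone.
  by apply: enorm_lt1_neq1; rewrite enorm_mulr_unit // clconj_mul_unit_sphere.
Qed.
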